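(* Let $\{(\xi_m,\tau_m)\}_{m=1}^M\subset\mathbb{R}^d\times(0,\infty)$ be a quadrature rule with positive weights that is exact on $P_\Lambda^3$, i.e. $\int_{\mathbb{R}^d}p(\xi)\rho(\xi)\,d\xi=\sum_{m=1}^M p(\xi_m)\tau_m$ for all $p\in P_\Lambda^3$, and let $\boldsymbol\Phi(\xi)=(\phi_1(\xi),\dots,\phi_K(\xi))^\top$. Let the stochastic Galerkin shallow water system be discretized in space by the central-upwind scheme described in the context and in time by forward Euler with step $\Delta t^n=t^{n+1}-t^n>0$, and let $\overline{\boldsymbol h}^n_{i,j}$, $\overline{\boldsymbol U}^n_{i,j}$ denote the numerical approximations to $\overline{\boldsymbol h}_{i,j}(t^n)$, $\overline{\boldsymbol U}_{i,j}(t^n)$. Assume $(\overline{\boldsymbol h}^n_{i,j})^\top\boldsymbol\Phi(\xi_m)>0$ for all $m\in[M]$ and all cells $i\in[N_x]$, $j\in[N_y]$. If $$\Delta t^n<\Delta t^n_h:=\min_{\substack{m\in[M]\\ i\in[N_x],\,j\in[N_y]}}\left|\frac{(\overline{\boldsymbol h}^n_{i,j})^\top\boldsymbol\Phi(\xi_m)}{\left[\dfrac{\mathcal F^{\widehat h}_{i+\frac12,j}(t_n)-\mathcal F^{\widehat h}_{i-\frac12,j}(t_n)}{\Delta x}+\dfrac{\mathcal G^{\widehat h}_{i,j+\frac12}(t_n)-\mathcal G^{\widehat h}_{i,j-\frac12}(t_n)}{\Delta y}\right]^\top\boldsymbol\Phi(\xi_m)}\right|$$ (a term with zero denominator being $+\infty$),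 then for every cell $(i,j)$ and every unit vector $\boldsymbol n=(n_x,n_y)^\top\in\mathbb{R}^2$, the flux Jacobian $J(\overline{\boldsymbol U}^{n+1}_{i,j})$ is well defined and diagonalizable with real eigenvalues.
   Context: **Polynomial space.** $\rho$ is a probability density on $\mathbb{R}^d$ with finite polynomial moments of all orders; $\langle f_1,f_2\rangle_\rho=\int f_1f_2\,\rho\,ds$. $\Lambda\subset\mathbb{N}_0^d$ is finite with $0\in\Lambda$, $|\Lambda|=K$; $P_\Lambda=\mathrm{span}\{\zeta^\nu:\nu\in\Lambda\}$; $P_\Lambda^r=\mathrm{span}\{\prod_{j=1}^r p_j: p_j\in P_\Lambda\}$; $\phi_1\equiv1,\phi_2,\dots,\phi_K$ is an $L^2_\rho$-orthonormal basis of $P_\Lambda$. For $\widehat z\in\mathbb{R}^K$, $\mathcal P(\widehat z)=\sum_{k=1}^K\widehat z_k\mathcal M_k$ with $(\mathcal M_k)_{\ell m}=\langle\phi_k,\phi_\ell\phi_m\rangle_\rho$. $[N]=\{1,\dots,N\}$. **System.** $\partial_t\widehat U+\partial_x\widehat F(\widehat U)+\partial_y\widehat G(\widehat U)=\widehat S$, with $\widehat U=(\widehat h^\top,\widehat{q^x}^\top,\widehat{q^y}^\top)^\top\in\mathbb{R}^{3K}$, $g>0$, source whose first $K$ components (the $\widehat h$-equations) vanish, and $$\widehat F(\widehat U)=\begin{pmatrix}\widehat{q^x}\\ \mathcal P(\widehat{q^x})\mathcal P^{-1}(\widehat h)\widehat{q^x}+\tfrac12 g\mathcal P(\widehat h)\widehat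 h\\ \mathcal P(\widehat{q^x})\mathcal P^{-1}(\widehat h)\widehat{q^y}\end{pmatrix},\quad \widehat G(\widehat U)=\begin{pmatrix}\widehat{q^y}\\ \mathcal P(\widehat{q^y})\mathcal P^{-1}(\widehat h)\widehat{q^x}\\ \mathcal P(\widehat{q^y})\mathcal P^{-1}(\widehat h)\widehat{q^y}+\tfrac12 g\mathcal P(\widehat h)\widehat h\end{pmatrix}.$$ **Flux Jacobian $J$.** For a unit vector $\boldsymbol n=(n_x,n_y)^\top$, and $\widehat U$ with $\mathcal P(\widehat h)$ positive definite, let $\widehat u=\mathcal P^{-1}(\widehat h)\widehat{q^x}$, $\widehat v=\mathcal P^{-1}(\widehat h)\widehat{q^y}$, $\mathsf B=\mathcal P(\widehat u)$, $\mathsf D=\mathcal P(\widehat v)$, $\mathsf E=\sqrt{g\mathcal P(\widehat h)}$ (symmetric positive definite square root), and $$\mathsf P=\begin{pmatrix}I&O&I\\ \mathsf B+n_x\mathsf E&-n_y\mathsf E&\mathsf B-n_x\mathsf E\\ \mathsf D+n_y\mathsf E&n_x\mathsf E&\mathsf D-n_y\mathsf E\end{pmatrix},\qquad J(\widehat U)=\mathsf P^{-1}\Big(n_x\frac{\partial\widehat F}{\partial\widehat U}(\widehat U)+n_y\frac{\partial\widehat G}{\partial\widehat U}(\widehat U)\Big)\mathsf P ,$$ where $\mathsf P$ is invertible; thus $J(\widehat U)$ is similar to $n_x\partial\widehat F/\partial\widehat U+n_y\partial\widehat G/\partial\widehat U$. **Scheme.** On a uniform rectangular grid of cells $\mathcal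 C_{i,j}$, $i\in[N_x]$, $j\in[N_y]$, with spacings $\Delta x,\Delta y$, $\overline{\boldsymbol U}_{i,j}=(\overline{\boldsymbol h}_{i,j}^\top,\overline{\boldsymbol q^x}_{i,j}^\top,\overline{\boldsymbol q^y}_{i,j}^\top)^\top\in\mathbb{R}^{3K}$ are approximate cell averages of $\widehat U$, and $\boldsymbol U^{W,E,S,N}_{i,j}$, with components $\boldsymbol h^{W,E,S,N}_{i,j},(\boldsymbol q^x)^{W,E,S,N}_{i,j},(\boldsymbol q^y)^{W,E,S,N}_{i,j}$, are point values at the midpoints of the west, east, south and north edges of $\mathcal C_{i,j}$ obtained from the cell averages by a piecewise linear reconstruction with slopes from the generalized minmod limiter (the height values being obtained by reconstructing the water surface and subtracting the bottom). The first $K$ equations of the semi-discrete scheme are $$\frac{d}{dt}\overline{\boldsymbol h}_{i,j}=-\frac{\mathcal F^{\widehat h}_{i+\frac12,j}-\mathcal F^{\widehat h}_{i-\frac12,j}}{\Delta x}-\frac{\mathcal G^{\widehat h}_{i,j+\frac12}-\mathcal G^{\widehat h}_{i,j-\frac12}}{\Delta y},$$ where (suppressing the indices on $a^\pm=a^\pm_{i+\frac12,j}$, $b^\pm=b^\pm_{i,j+\frac12}$) $$\mathcal F^{\widehat h}_{i+\frac12,j}=\frac{a^+(\boldsymbol q^x)^E_{i,j}-a^-(\boldsymbol q^x)^W_{i+1,j}}{a^+-a^-}+\frac{a^+a^-}{a^+-a^-}[\boldsymbol h^W_{i+1,j}-\boldsymbol h^E_{i,j}],$$ $$\mathcal G^{\widehat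 h}_{i,j+\frac12}=\frac{b^+(\boldsymbol q^y)^N_{i,j}-b^-(\boldsymbol q^y)^S_{i,j+1}}{b^+-b^-}+\frac{b^+b^-}{b^+-b^-}[\boldsymbol h^S_{i,j+1}-\boldsymbol h^N_{i,j}],$$ and $a^-_{i+\frac12,j}$ (resp. $a^+_{i+\frac12,j}$) is the minimum (resp. maximum) of $0$ and all eigenvalues of $\frac{\partial\widehat F}{\partial\widehat U}$ at $\boldsymbol U^W_{i+1,j}$ and $\boldsymbol U^E_{i,j}$, while $b^-_{i,j+\frac12}$ (resp. $b^+_{i,j+\frac12}$) is the minimum (resp. maximum) of $0$ and all eigenvalues of $\frac{\partial\widehat G}{\partial\widehat U}$ at $\boldsymbol U^S_{i,j+1}$ and $\boldsymbol U^N_{i,j}$. Standing assumption: the system is hyperbolic at the reconstructed values (the matrices $\mathcal P(\boldsymbol h^{W,E,S,N}_{i,j})$ are positive definite), so these speeds are real. $\mathcal F^{\widehat h}(t_n),\mathcal G^{\widehat h}(t_n)$ are the fluxes computed from the data at time $t^n$. Forward Euler gives $$\overline{\boldsymbol h}^{n+1}_{i,j}=\overline{\boldsymbol h}^{n}_{i,j}-\Delta t^n\Big[\frac{\mathcal F^{\widehat h}_{i+\frac12,j}(t_n)-\mathcal F^{\widehat h}_{i-\frac12,j}(t_n)}{\Delta x}+\frac{\mathcal G^{\widehat h}_{i,j+\frac12}(t_n)-\mathcal G^{\widehat h}_{i,j-\frac12}(t_n)}{\Delta y}\Big],$$ with $\overline{\boldsymbol q^x}^{n+1}_{i,j},\overline{\boldsymbol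 q^y}^{n+1}_{i,j}\in\mathbb{R}^K$ updated by forward Euler in the remaining equations. *)

(* Defs.v *)
From HB Require Import structures.
From mathcomp Require Import all_boot all_order all_algebra finmap.
From mathcomp Require Import all_classical all_reals all_analysis.
From mathcomp.real_closed Require Import complex.

Set Implicit Arguments.
Unset Strict Implicit.
Unset Printing Implicit Defensive.

Import Order.TTheory GRing.Theory Num.Theory numFieldNormedType.Exports.

Local Open Scope classical_set_scope.
Local Open Scope ring_scope.

(* Tuples, unlike row vectors, carry the product sigma-algebra in the library. *)
Definition Rd (R : realType) (d : nat) := d.-tuple (measurableTypeR R).

Section lebesgue_Rd.
Variable R : realType.

Definition consRd d (p : measurableTypeR R * Rd R d) : Rd R d.+1 :=
  [tuple of p.1 :: p.2].

Lemma measurable_consRd d : measurable_fun setT (@consRd d).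
Proof. exact: measurable_cons measurable_fst measurable_snd. Qed.

Section step.
Variables (leb : {sigma_finite_measure set (measurableTypeR R) -> \bar R}).
Variables (d : nat) (mu : {sigma_finite_measure set (Rd R d) -> \bar R}).

Definition lebesgue_step : set (Rd R d.+1) -> \bar R :=
  pushforward (leb \x mu)%E (@consRd d).

HB.instance Definition _ := Measure.copy lebesgue_step
  (measure_function_pushforward__canonical__measure_function_Measure
     (leb \x mu)%E (@measurable_consRd d)).

(* The library's sigma-finiteness instance for [_ \x _] is shadowed by the one
   for products of subprobabilities. *)
Let prod_sigma_finite : sigma_finite setT (leb \x mu)%E.
Proof.
have /sigma_finiteP[F [TF ndF Foo]] := sigma_finiteT leb.
have /sigma_finiteP[G [TG ndG Goo]] := sigma_finiteT mu.
exists (fun n => F n `*` G n).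
 rewrite -setXTT TF TG predeqE => -[x y]; split.
    move=> [/= [n _ Fnx] [k _ Gky]]; exists (maxn n k) => //; split.
    - by move: x Fnx; exact/subsetPset/ndF/leq_maxl.
    - by move: y Gky; exact/subsetPset/ndG/leq_maxr.
  by move=> [n _ []/= ? ?]; split; exists n.
move=> k; have [? ?] := Foo k; have [? ?] := Goo k.
split; first exact: measurableX.
by rewrite product_measure1E// lte_mul_pinfty// ge0_fin_numE.
Qed.

Let lebesgue_step_sigma_finite : sigma_finite setT lebesgue_step.
Proof.
have [F TF FE] := prod_sigma_finite.
pose un (t : Rd R d.+1) : measurableTypeR R * Rd R d :=
  (thead t, [tuple of behead t]).
have mun : measurable_fun setT un.
  apply: measurable_fun_pair; first exact: measurable_tnth.
  exact: measurable_behead.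
have unK : cancel (@consRd d) un.
  by move=> [x t]; rewrite /un/= theadE; congr pair; exact/val_inj.
exists (fun n => un @^-1` F n).
  by rewrite -preimage_bigcup -TF preimage_setT.
move=> n; have [mF Foo] := FE n; split.
  by rewrite -[X in measurable X]setTI; exact: mun.
rewrite /lebesgue_step /pushforward -comp_preimage.
by rewrite (_ : un \o _ = id)//; apply/funext => x /=; rewrite unK.
Qed.

HB.instance Definition _ := Measure_isSigmaFinite.Build _ _ _
  lebesgue_step lebesgue_step_sigma_finite.

End step.

Fixpoint lebesgue_Rd d : {sigma_finite_measure set (Rd R d) -> \bar R} :=
  match d with
  | 0 => @dirac _ (Rd R 0) [tuple] R
  | d'.+1 => lebesgue_step (@lebesgue_measure R) (lebesgue_Rd d')
  end.

End lebesgue_Rd.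

Arguments lebesgue_Rd {R d}.

Section polynomial_space.
Variables (R : realType) (d : nat).
Implicit Types (f : Rd R d -> R) (nu : d.-tuple nat) (Lambda : {fset d.-tuple nat}).

Definition monomial nu : Rd R d -> R :=
  fun s => \prod_(i < d) (tnth s i : R) ^+ tnth nu i.

Definition fspan (S : set (Rd R d -> R)) : set (Rd R d -> R) :=
  [set f | exists n (c : 'I_n -> R) (e : 'I_n -> Rd R d -> R),
     (forall i, S (e i)) /\ f = fun s => \sum_(i < n) c i * e i s].

Definition polyspace Lambda : set (Rd R d -> R) :=
  fspan [set monomial nu | nu in [set` Lambda]].

Definition polyspace_prod Lambda (r : nat) : set (Rd R d -> R) :=
  fspan [set f | exists p : 'I_r -> Rd R d -> R,
     (forall j, polyspace Lambda (p j)) /\ f = fun s => \prod_(j < r) p j s].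

Definition density (rho : Rd R d -> R) :=
  [/\ measurable_fun setT rho, (forall s, 0 <= rho s) &
      (\int[lebesgue_Rd]_s (rho s)%:E = 1)%E].

Definition finite_moments (rho : Rd R d -> R) :=
  forall nu, lebesgue_Rd.-integrable setT
    (fun s => (monomial nu s * rho s)%:E).

Definition ip (rho f1 f2 : Rd R d -> R) : R :=
  \int[lebesgue_Rd]_s (f1 s * f2 s * rho s).

Definition orthonormal_basis (rho : Rd R d -> R) Lambda (K : nat)
    (phi : 'I_K -> Rd R d -> R) :=
  (forall k l, ip rho (phi k) (phi l) = (k == l)%:R) /\
  fspan (range phi) = polyspace Lambda.

(* Real-valued Lebesgue integrals return the junk value 0 when the integral is
   infinite; under [finite_moments] the polynomial integrands here and in [ip]
   are integrable. *)
Definition exact_quadrature (rho : Rd R d -> R) (V : set (Rd R d -> R))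
    (M : nat) (xi : 'I_M -> Rd R d) (tau : 'I_M -> R) :=
  forall p, V p ->
    \int[lebesgue_Rd]_s (p s * rho s) = \sum_(m < M) p (xi m) * tau m.

End polynomial_space.

Section matrices.
Variables (R : realType) (n : nat).
Implicit Types A E : 'M[R]_n.

Definition posdefmx A :=
  A^T = A /\ forall x : 'cV[R]_n, x != 0 -> 0 < (x^T *m A *m x) ord0 ord0.

Definition is_posdef_sqrt A E := posdefmx E /\ E *m E = A.

Definition mxsqrt A : 'M[R]_n := xget 0 [set E | is_posdef_sqrt A E].

(* [diagonalizable] is over the base field [R], hence already yields a real
   diagonal form; the second clause spells out that the complex spectrum is
   real. *)
Definition real_diagonalizable A :=
  diagonalizable A /\
  forall z : R[i], eigenvalue (map_mx (real_complex R) A) z ->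
    z \is Num.real.

(* [jacobian] is the matrix of the differential acting on row vectors. *)
Definition coljacobian (F : 'cV[R]_n -> 'cV[R]_n) (U : 'cV[R]_n) : 'M[R]_n :=
  (jacobian (fun v : 'rV[R]_n => (F v^T)^T) U^T)^T.

End matrices.

Notation state R K := 'cV[R]_(K + (K + K)).

Section state.
Variables (R : realType) (K : nat).

Definition mkstate (h qx qy : 'cV[R]_K) : state R K :=
  col_mx h (col_mx qx qy).
Definition hpart (U : state R K) : 'cV[R]_K := usubmx U.
Definition qxpart (U : state R K) : 'cV[R]_K := usubmx (dsubmx U).
Definition qypart (U : state R K) : 'cV[R]_K := dsubmx (dsubmx U).

End state.

Section shallow_water.
Variables (R : realType) (d K : nat).
Variables (rho : Rd R d -> R) (phi : 'I_K -> Rd R d -> R) (g : R).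
Implicit Types (z : 'cV[R]_K) (U : state R K).

Definition tripmx (k : 'I_K) : 'M[R]_K :=
  \matrix_(l < K, m < K) ip rho (phi k) (fun s => phi l s * phi m s).

Definition Pmx z : 'M[R]_K := \sum_(k < K) z k ord0 *: tripmx k.

Definition uhat U := invmx (Pmx (hpart U)) *m qxpart U.
Definition vhat U := invmx (Pmx (hpart U)) *m qypart U.

Definition fluxF U : state R K :=
  let h := hpart U in let qx := qxpart U in let qy := qypart U in
  mkstate qx
    (Pmx qx *m invmx (Pmx h) *m qx + (g / 2) *: (Pmx h *m h))
    (Pmx qx *m invmx (Pmx h) *m qy).

Definition fluxG U : state R K :=
  let h := hpart U in let qx := qxpart U in let qy := qypart U in
  mkstate qy
    (Pmx qy *m invmx (Pmx h) *m qx)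
    (Pmx qy *m invmx (Pmx h) *m qy + (g / 2) *: (Pmx h *m h)).

Definition similmx (nx ny : R) U : 'M[R]_(K + (K + K)) :=
  let B := Pmx (uhat U) in
  let D := Pmx (vhat U) in
  let E := mxsqrt (g *: Pmx (hpart U)) in
  col_mx (row_mx 1%:M (row_mx 0 1%:M))
 (col_mx (row_mx (B + nx *: E) (row_mx (- ny *: E) (B - nx *: E)))
         (row_mx (D + ny *: E) (row_mx (nx *: E) (D - ny *: E)))).

Definition flux_jacobian (nx ny : R) U : 'M[R]_(K + (K + K)) :=
  invmx (similmx nx ny U)
    *m (nx *: coljacobian fluxF U + ny *: coljacobian fluxG U)
    *m similmx nx ny U.

(* [flux_jacobian] is total in Rocq: [invmx], [mxsqrt] and [jacobian] return
   junk values outside of their domains, which this predicate rules out. *)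
Definition flux_jacobian_defined (nx ny : R) U :=
  [/\ posdefmx (Pmx (hpart U)),
      (exists! E, is_posdef_sqrt (g *: Pmx (hpart U)) E),
      differentiable fluxF U,
      differentiable fluxG U &
      similmx nx ny U \in unitmx].

End shallow_water.

(* Cells are indexed by integers, cell (i, j) of the grid having 1 <= i <= Nx
   and 1 <= j <= Ny; the values at the other indices are those of the ghost
   cells by which boundary conditions are imposed. *)

Section reconstruction.
Variables (R : realType) (theta dx dy : R).

Definition minmod3 (a b c : R) : R :=
  if [&& 0 < a, 0 < b & 0 < c] then Num.min a (Num.min b c)
  else if [&& a < 0, b < 0 & c < 0] then Num.max a (Num.max b c)
  else 0.

(* Generalized minmod limiter, applied componentwise. *)
Definition minmod_slope n (delta : R) (Vl V Vr : 'cV[R]_n) : 'cV[R]_n :=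
  \col_(k < n) minmod3 (theta * ((V k ord0 - Vl k ord0) / delta))
                       ((Vr k ord0 - Vl k ord0) / (2 * delta))
                       (theta * ((Vr k ord0 - V k ord0) / delta)).

Variables (n : nat) (V : int -> int -> 'cV[R]_n).

Definition slope_x (i j : int) :=
  minmod_slope dx (V (i - 1) j) (V i j) (V (i + 1) j).
Definition slope_y (i j : int) :=
  minmod_slope dy (V i (j - 1)) (V i j) (V i (j + 1)).

Definition reconW i j := V i j - (dx / 2) *: slope_x i j.
Definition reconE i j := V i j + (dx / 2) *: slope_x i j.
Definition reconS i j := V i j - (dy / 2) *: slope_y i j.
Definition reconN i j := V i j + (dy / 2) *: slope_y i j.

End reconstruction.

Section point_values.
Variables (R : realType) (K : nat) (theta dx dy : R).
(* Bottom: value in cell (i, j), and values at the midpoints of the edges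
   (i + 1/2, j) and (i, j + 1/2). *)
Variables (bot botx boty : int -> int -> 'cV[R]_K).
Variable U : int -> int -> state R K.

Definition surface i j : 'cV[R]_K := hpart (U i j) + bot i j.
Let qx i j := qxpart (U i j).
Let qy i j := qypart (U i j).

Definition UW (i j : int) : state R K :=
  mkstate (reconW theta dx surface i j - botx (i - 1) j)
          (reconW theta dx qx i j) (reconW theta dx qy i j).
Definition UE (i j : int) : state R K :=
  mkstate (reconE theta dx surface i j - botx i j)
          (reconE theta dx qx i j) (reconE theta dx qy i j).
Definition US (i j : int) : state R K :=
  mkstate (reconS theta dy surface i j - boty i (j - 1))
          (reconS theta dy qx i j) (reconS theta dy qy i j).
Definition UN (i j : int) : state R K :=
  mkstate (reconN theta dy surface i j - boty i j)
          (reconN theta dy qx i j) (reconN theta dy qy i j).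

End point_values.

Section speeds.
Variables (R : realType) (n : nat).
Implicit Types A B : 'M[R]_n.

(* The set is finite and contains 0, so that [inf] and [sup] are attained. *)
Definition speeds A B : set R :=
  [set a | [\/ a = 0, eigenvalue A a | eigenvalue B a]].
Definition speed_min A B : R := inf (speeds A B).
Definition speed_max A B : R := sup (speeds A B).

Definition cu_flux m (am ap : R) (fl fr ul ur : 'cV[R]_m) : 'cV[R]_m :=
  (ap - am)^-1 *: (ap *: fl - am *: fr)
  + (ap * am / (ap - am)) *: (ur - ul).

End speeds.

Section central_upwind.
Variables (R : realType) (d K : nat).
Variables (rho : Rd R d -> R) (phi : 'I_K -> Rd R d -> R) (g : R).
Variables (theta dx dy : R).
Variables (bot botx boty : int -> int -> 'cV[R]_K).
Variable U : int -> int -> state R K.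

Local Notation F := (fluxF rho phi g).
Local Notation G := (fluxG rho phi g).
Local Notation UW := (UW theta dx bot botx U).
Local Notation UE := (UE theta dx bot botx U).
Local Notation US := (US theta dy bot boty U).
Local Notation UN := (UN theta dy bot boty U).

(* Index (i, j) stands for the edge (i + 1/2, j) in [am], [ap], [Fflux] and for
   the edge (i, j + 1/2) in [bm], [bp], [Gflux]. *)
Definition am (i j : int) : R :=
  speed_min (coljacobian F (UW (i + 1) j)) (coljacobian F (UE i j)).
Definition ap (i j : int) : R :=
  speed_max (coljacobian F (UW (i + 1) j)) (coljacobian F (UE i j)).
Definition bm (i j : int) : R :=
  speed_min (coljacobian G (US i (j + 1))) (coljacobian G (UN i j)).
Definition bp (i j : int) : R :=
  speed_max (coljacobian G (US i (j + 1))) (coljacobian G (UN i j)).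

Definition Fflux (i j : int) : state R K :=
  cu_flux (am i j) (ap i j) (F (UE i j)) (F (UW (i + 1) j))
          (UE i j) (UW (i + 1) j).
Definition Gflux (i j : int) : state R K :=
  cu_flux (bm i j) (bp i j) (G (UN i j)) (G (US i (j + 1)))
          (UN i j) (US i (j + 1)).

Definition Fflux_h (i j : int) : 'cV[R]_K :=
  cu_flux (am i j) (ap i j) (qxpart (UE i j)) (qxpart (UW (i + 1) j))
          (hpart (UE i j)) (hpart (UW (i + 1) j)).
Definition Gflux_h (i j : int) : 'cV[R]_K :=
  cu_flux (bm i j) (bp i j) (qypart (UN i j)) (qypart (US i (j + 1)))
          (hpart (UN i j)) (hpart (US i (j + 1))).

Definition fluxdiff_h (i j : int) : 'cV[R]_K :=
  dx^-1 *: (Fflux_h i j - Fflux_h (i - 1) j)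
  + dy^-1 *: (Gflux_h i j - Gflux_h i (j - 1)).

Definition fluxdiff (i j : int) : state R K :=
  dx^-1 *: (Fflux i j - Fflux (i - 1) j)
  + dy^-1 *: (Gflux i j - Gflux i (j - 1)).

Variables Nx Ny : nat.

Definition in_grid (i j : int) : bool :=
  (1 <= i <= Nx%:Z) && (1 <= j <= Ny%:Z).

(* Positive definiteness at both sides of every edge of the grid, boundary
   edges included. *)
Definition hyperbolic_point_values :=
  (forall i j : int, 0 <= i <= Nx%:Z -> 1 <= j <= Ny%:Z ->
     posdefmx (Pmx rho phi (hpart (UE i j))) /\
     posdefmx (Pmx rho phi (hpart (UW (i + 1) j)))) /\
  (forall i j : int, 1 <= i <= Nx%:Z -> 0 <= j <= Ny%:Z ->
     posdefmx (Pmx rho phi (hpart (UN i j))) /\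
     posdefmx (Pmx rho phi (hpart (US i (j + 1))))).

Definition pce_eval (z : 'cV[R]_K) (s : Rd R d) : R :=
  \sum_(k < K) z k ord0 * phi k s.

Variables (M : nat) (xi : 'I_M -> Rd R d).

Definition dt_ratio (m : 'I_M) (i j : int) : \bar R :=
  let den := pce_eval (fluxdiff_h i j) (xi m) in
  if den == 0 then +oo%E
  else (`| pce_eval (hpart (U i j)) (xi m) / den |)%:E.

Definition dt_max : \bar R :=
  \big[mine/+oo%E]_(m < M) \big[mine/+oo%E]_(i < Nx) \big[mine/+oo%E]_(j < Ny)
    dt_ratio m i.+1 j.+1.

(* [src] is the discretized source of the momentum equations; the source of the
   height equations vanishes. *)
Definition euler_step (dt : R) (src : int -> int -> 'cV[R]_(K + K))
    (U1 : int -> int -> state R K) :=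
  forall i j, in_grid i j ->
    hpart (U1 i j) = hpart (U i j) - dt *: fluxdiff_h i j /\
    dsubmx (U1 i j) = dsubmx (U i j) - dt *: dsubmx (fluxdiff i j)
                      + dt *: src i j.

End central_upwind.

(* Main.v *)
(* The time step bound keeps the forward Euler update of the water height positive
   at the quadrature nodes.  Since the rule is exact on triple products,
   [P(h) = Phi W Phi^T], where [Phi] collects the values of the basis at the nodes
   and [W] is diagonal with entries [tau_m h(xi_m) > 0]; moreover
   [Phi diag(tau) Phi^T = 1], so [Phi^T] is injective and [P(h)] is positive
   definite.  In terms of the increments of [h] and of the velocities, the latter
   scaled by [E = sqrt (g P(h))], both flux Jacobians are symmetric, the key point
   being that [E^-1 P(q) P(h)^-1 E = g E^-1 P(q) E^-1].  Hence so is any linear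
   combination of them, and it is diagonalizable over the reals. *)

Require Import Defs.
From HB Require Import structures.
From mathcomp Require Import all_boot all_order all_algebra finmap.
From mathcomp Require Import all_classical all_reals all_analysis.
From mathcomp.real_closed Require Import complex.
From mathcomp Require Import ring lra.

Set Implicit Arguments.
Unset Strict Implicit.
Unset Printing Implicit Defensive.

Import Order.TTheory GRing.Theory Num.Theory numFieldNormedType.Exports.

Local Open Scope classical_set_scope.
Local Open Scope ring_scope.

(** * Cancellation and intertwining of matrices *)

Lemma mulmx_unitl_inj (F : fieldType) m n (P : 'M[F]_m) (A B : 'M[F]_(m, n)) :
  P \in unitmx -> P *m A = P *m B -> A = B.
Proof. by move=> Pu PAB; rewrite -(mulKmx Pu A) PAB mulKmx. Qed.

Lemma mulmx_unitr_inj (F : fieldType) m n (P : 'M[F]_n) (A B : 'M[F]_(m, n)) :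
  P \in unitmx -> A *m P = B *m P -> A = B.
Proof. by move=> Pu APB; rewrite -(mulmxK Pu A) APB mulmxK. Qed.

Lemma intertwine_lincomb (R : comNzRingType) n (Q A1 A2 B1 B2 : 'M[R]_n)
    (a b : R) :
  Q *m A1 = B1 *m Q -> Q *m A2 = B2 *m Q ->
  Q *m (a *: A1 + b *: A2) = (a *: B1 + b *: B2) *m Q.
Proof.
move=> QA1 QA2; rewrite mulmxDr mulmxDl -!scalemxAr -!scalemxAl.
by rewrite QA1 QA2.
Qed.

(** * Real symmetric matrices: diagonalization, functional calculus, positive definite square
    roots *)

Section symmetric_matrices.
Variable R : realType.

Lemma diagonalizable_eqP n (A : 'M[R]_n) : diagonalizable A <->
  exists P (d : 'rV[R]_n), P \in unitmx /\ P *m A = diag_mx d *m P.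
Proof.
split=> [[P Pu /diag_mxP[d]]|[P [d [Pu PA]]]].
  rewrite conjumx// => PAP; exists P, d; split=> //.
  by rewrite -PAP mulmxKV.
by exists P => //; apply/diag_mxP; exists d; rewrite conjumx// PA mulmxK.
Qed.

Lemma diagonalizable_similar n (A B Q : 'M[R]_n) : Q \in unitmx ->
  Q *m A = B *m Q -> diagonalizable B -> diagonalizable A.
Proof.
move=> Qu QA /diagonalizable_eqP[P [d [Pu PB]]]; apply/diagonalizable_eqP.
exists (P *m Q), d; rewrite unitmx_mul Pu; split=> //.
by rewrite -mulmxA QA !mulmxA PB.
Qed.

(** A diagonalization over the reals remains one over the complex numbers. Carried through it, an
    eigenvector for [z] becomes an eigenvector of a diagonal matrix with real entries, and any
    nonzero coordinate identifies [z] with one of these entries. *)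
Lemma diagonalizable_real n (A : 'M[R]_n) :
  diagonalizable A -> real_diagonalizable A.
Proof.
move=> diagA; split=> // z /eigenvalueP[v vA v0].
have /diagonalizable_eqP[P [d [Pu PA]]] := diagA.
pose f := real_complex R.
have PuC : map_mx f P \in unitmx by rewrite map_unitmx.
have PAC : map_mx f P *m map_mx f A = diag_mx (map_mx f d) *m map_mx f P.
  by rewrite -map_diag_mx -!map_mxM PA.
have [w w0 wd] : exists2 w : 'rV_n, w != 0 & w *m diag_mx (map_mx f d) = z *: w.
  exists (v *m invmx (map_mx f P)).
    by apply: contraNneq v0 => w0; rewrite -(mulmxKV PuC v) w0 mul0mx.
  apply: (mulmx_unitr_inj PuC).
  by rewrite -mulmxA -PAC mulmxA mulmxKV// vA -scalemxAl mulmxKV.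
have /rV0Pn[i wi0] := w0.
have /rowP/(_ i) := wd; rewrite mul_mx_diag !mxE mulrC => /(mulIf wi0) <-.
by apply/complex_realP; exists (d 0 i).
Qed.

(** The complexification is normal and hermitian, so the complex spectral theorem makes it similar
    to a real diagonal matrix. Two real matrices that are similar over the complex numbers are
    similar over the reals. *)
Lemma symmetric_diagonalizable n (A : 'M[R]_n) : A^T = A -> diagonalizable A.
Proof.
move=> symA; pose f := real_complex R; pose AC := map_mx f A.
have realAC : AC \is a mxOver Num.real.
  by apply/mxOverP => i j; rewrite mxE; apply/complex_realP; exists (A i j).
have ACsym : AC \is symmetricmx.
  by rewrite qualifE/= expr0 scale1r map_mx_id// /AC map_trmx symA.
have ACE := orthomx_spectralP (symmetric_normalmx ACsym realAC).
have /mxOverP dreal :=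
  hermitian_spectral_diag_real (realsym_hermsym ACsym realAC).
pose d := map_mx (@complex.Re R) (spectral_diag AC).
have dE : spectral_diag AC = map_mx f d.
  by apply/rowP => i; rewrite !mxE /f RRe_real.
have [|||Q] := @real_similar _ _ AC (diag_mx (map_mx f d)).
- exists (spectralmx AC); first exact: spectral_unit.
  apply/similarP; first exact: spectral_unit.
  by rewrite {2}ACE dE !mulmxA mulmxV ?mul1mx// spectral_unit.
- exact: realAC.
- apply/mxOverP => i j; rewrite -map_diag_mx mxE; apply/complex_realP.
  by eexists.
rewrite inE => /andP[/mxOverP realQ Qu] /(similarP Qu) QA.
pose P := map_mx (@complex.Re R) Q.
have QE : Q = map_mx f P by apply/matrixP => i j; rewrite !mxE /f RRe_real.
apply/diagonalizable_eqP; exists P, d; split.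
  by move: Qu; rewrite QE map_unitmx.
by apply: (map_mx_inj (f := f)); rewrite !map_mxM -QE map_diag_mx.
Qed.

(** Entrywise, commutation says [A i j * (d j - d i) = 0]: where the entry of [A] is nonzero,
    [d i = d j], hence also [f (d i) = f (d j)]. *)
Lemma comm_diag_mx_map n (f : R -> R) (A : 'M[R]_n) (d : 'rV[R]_n) :
  A *m diag_mx d = diag_mx d *m A ->
  A *m diag_mx (map_mx f d) = diag_mx (map_mx f d) *m A.
Proof.
rewrite !mul_mx_diag !mul_diag_mx => /matrixP Ad; apply/matrixP => i j.
have := Ad i j; rewrite !mxE [RHS]mulrC => /eqP.
rewrite -subr_eq0 -mulrBr mulf_eq0 subr_eq0 => /orP[/eqP->|/eqP->].
  by rewrite mulr0 mul0r.
by rewrite mulrC.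
Qed.

Section functional_calculus.
Variables (n : nat) (A P : 'M[R]_n) (d : 'rV[R]_n).
Hypothesis Pu : P \in unitmx.
Hypothesis PA : P *m A = diag_mx d *m P.

(** The matrix [f(A)], read off a diagonalization of [A]. The matrix [P] is invertible but not
    assumed orthogonal. *)
Definition mxfun (f : R -> R) : 'M[R]_n :=
  invmx P *m diag_mx (map_mx f d) *m P.

Lemma mxfunE f : P *m mxfun f = diag_mx (map_mx f d) *m P.
Proof. by rewrite /mxfun -mulmxA mulKVmx. Qed.

(** Symmetry of [A] makes [P *m P^T] commute with [diag_mx d], hence with its image under [f]; this
    takes the place of orthogonality of [P]. *)
Lemma mxfun_sym f : A^T = A -> (mxfun f)^T = mxfun f.
Proof.
move=> symA; have PTu : P^T \in unitmx by rewrite unitmx_tr.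
have comm : P *m P^T *m diag_mx d = diag_mx d *m (P *m P^T).
  rewrite -mulmxA -{1}(tr_diag_mx d) -trmx_mul -PA trmx_mul symA.
  by rewrite !mulmxA PA.
apply: (mulmx_unitl_inj Pu); apply: (mulmx_unitr_inj PTu).
rewrite -mulmxA -trmx_mul mxfunE trmx_mul tr_diag_mx mulmxA.
by rewrite (comm_diag_mx_map f comm) mulmxA.
Qed.

Lemma comm_mxfun f X : X *m A = A *m X -> X *m mxfun f = mxfun f *m X.
Proof.
move=> XA; pose Y := P *m X *m invmx P.
have YP : Y *m P = P *m X by rewrite /Y mulmxKV.
have comm : Y *m diag_mx d = diag_mx d *m Y.
  apply: (mulmx_unitr_inj Pu); rewrite -mulmxA -PA mulmxA YP.
  by rewrite -[RHS]mulmxA YP -mulmxA XA !mulmxA PA.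
apply: (mulmx_unitl_inj Pu).
rewrite mulmxA -YP -mulmxA mxfunE mulmxA (comm_diag_mx_map f comm).
by rewrite -mulmxA YP [RHS]mulmxA mxfunE mulmxA.
Qed.

Lemma mxfunM f1 f2 : mxfun f1 *m mxfun f2 = mxfun (fun x => f1 x * f2 x).
Proof.
apply: (mulmx_unitl_inj Pu); rewrite mulmxA !mxfunE -mulmxA mxfunE mulmxA.
congr (_ *m _); apply/matrixP => i j; rewrite mul_diag_mx !mxE.
by case: eqP => [->|]; rewrite ?mulr1n// mulr0n mulr0.
Qed.

Lemma mxfun_id f : (forall i, f (d 0 i) = d 0 i) -> mxfun f = A.
Proof.
move=> fd; apply: (mulmx_unitl_inj Pu); rewrite mxfunE PA.
by congr (diag_mx _ *m _); apply/rowP => i; rewrite mxE fd.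
Qed.

Lemma mxfun_unit f : (forall i, f (d 0 i) != 0) -> mxfun f \in unitmx.
Proof.
move=> fd0; rewrite !unitmx_mul unitmx_inv Pu/= andbT unitmxE det_diag.
by rewrite unitfE; apply/prodf_neq0 => i _; rewrite mxE.
Qed.

End functional_calculus.

Lemma sqnorm_gt0 n (x : 'cV[R]_n) : x != 0 -> 0 < (x^T *m x) ord0 ord0.
Proof.
move=> /cV0Pn[i xi0]; rewrite mxE (bigD1 i)//= mxE ltr_wpDr ?sumr_ge0//.
  by move=> j _; rewrite mxE -expr2 sqr_ge0.
by rewrite -expr2 lt_def sqr_ge0 expf_neq0.
Qed.

Lemma posdefmx_unit n (A : 'M[R]_n) : posdefmx A -> A \in unitmx.
Proof.
move=> [_ posA]; rewrite unitmxE unitfE; apply/negP => /det0P[v v0 vA].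
have := posA v^T; rewrite trmxK vA mul0mx mxE ltxx => /(_ _)/negP; apply.
  by rewrite -[0]trmx0 (inj_eq trmx_inj).
by [].
Qed.

Lemma posdefmx_gram n (S : 'M[R]_n) : S \in unitmx -> posdefmx (S^T *m S).
Proof.
move=> Su; split; first by rewrite trmx_mul trmxK.
move=> x x0; rewrite mulmxA -mulmxA -trmx_mul; apply: sqnorm_gt0.
by apply: contraNneq x0 => Sx; rewrite -(mulKmx Su x) Sx mulmx0.
Qed.

Lemma posdefmxD n (A B : 'M[R]_n) :
  posdefmx A -> posdefmx B -> posdefmx (A + B).
Proof.
move=> [symA posA] [symB posB]; split; first by rewrite linearD/= symA symB.
by move=> x x0; rewrite mulmxDr mulmxDl mxE addr_gt0 ?posA ?posB.
Qed.

Lemma posdefmxZ n (a : R) (A : 'M[R]_n) :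
  0 < a -> posdefmx A -> posdefmx (a *: A).
Proof.
move=> a0 [symA posA]; split; first by rewrite linearZ/= symA.
by move=> x x0; rewrite -scalemxAr -scalemxAl mxE mulr_gt0 ?posA.
Qed.

Lemma posdefmx_diag n (w : 'rV[R]_n) :
  (forall i, 0 < w 0 i) -> posdefmx (diag_mx w).
Proof.
move=> w_gt0; split=> [|x /cV0Pn[i xi0]]; first exact: tr_diag_mx.
have wx_ge0 j : 0 <= x j 0 * w 0 j * x j 0.
  by rewrite mulrAC -expr2 mulr_ge0 ?sqr_ge0// ltW.
rewrite mul_mx_diag mxE (bigD1 i)//= !mxE ltr_wpDr ?sumr_ge0//.
  by move=> j _; rewrite !mxE.
by rewrite mulrAC -expr2 mulr_gt0// lt_def sqr_ge0 expf_neq0.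
Qed.

(** Each row [v] of [P] is a left eigenvector, so [v A v^T = d_i v v^T], where both quadratic forms
    are positive. *)
Lemma posdefmx_diag_gt0 n (A P : 'M[R]_n) (d : 'rV[R]_n) :
  posdefmx A -> P \in unitmx -> P *m A = diag_mx d *m P ->
  forall i, 0 < d 0 i.
Proof.
move=> [_ posA] Pu PA i; pose v := row i P.
have v0 : v^T != 0.
  rewrite -[0]trmx0 (inj_eq trmx_inj); apply/eqP => v0.
  have := congr1 (row i) (mulmxV Pu); rewrite row_mul -/v v0 mul0mx.
  by move=> /rowP/(_ i)/eqP; rewrite !mxE eqxx eq_sym oner_eq0.
have vA : v *m A = d 0 i *: v.
  by rewrite /v -row_mul PA row_mul row_diag_mx -scalemxAl -rowE.
have := posA _ v0; rewrite trmxK vA -scalemxAl mxE pmulr_lgt0//.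
by have := sqnorm_gt0 v0; rewrite trmxK.
Qed.

(* Uniqueness: another root [X] commutes with [A = X^2], hence with [E], so that
   [(E - X) (E + X) = 0] with [E + X] positive definite. *)
Lemma posdef_sqrt_ex n (A : 'M[R]_n) :
  posdefmx A -> exists! E, is_posdef_sqrt A E.
Proof.
move=> posA; have [symA _] := posA.
have /diagonalizable_eqP[P [d [Pu PA]]] := symmetric_diagonalizable symA.
have d0 := posdefmx_diag_gt0 posA Pu PA.
pose E := mxfun P d (@Num.sqrt R).
have EE : E *m E = A.
  by rewrite mxfunM// (mxfun_id Pu PA)// => i; rewrite -expr2 sqr_sqrtr ?ltW.
have posE : posdefmx E.
  (* The fourth root of [A] exhibits [E] as a Gram matrix, hence as positive definite. *)
  pose S := mxfun P d (fun x => Num.sqrt (Num.sqrt x)).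
  have -> : E = S^T *m S.
    rewrite (mxfun_sym Pu PA)// mxfunM//; congr (mxfun _ _ _); apply/funext => x.
    by rewrite -expr2 sqr_sqrtr// sqrtr_ge0.
  by apply/posdefmx_gram/mxfun_unit => // i; rewrite gt_eqF// !sqrtr_gt0.
exists E; split=> // X [posX XX].
have XE : X *m E = E *m X by apply: (comm_mxfun Pu PA); rewrite -XX mulmxA.
apply/eqP; rewrite -subr_eq0; apply/eqP.
apply: (mulmx_unitr_inj (posdefmx_unit (posdefmxD posE posX))).
by rewrite mul0mx mulmxDr !mulmxBl EE XX XE addrC addrA subrK subrr.
Qed.

Lemma mxsqrtP n (A : 'M[R]_n) : posdefmx A -> is_posdef_sqrt A (mxsqrt A).
Proof.
by move=> /posdef_sqrt_ex[E [EA _]]; exact: (xgetPex 0 (ex_intro _ E EA)).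
Qed.

End symmetric_matrices.

(** * Differentials of matrix-valued maps *)

Section matrix_differentials.
Variable R : realType.

(** The first-order expansion depends only on the germ at [x]. This serves for [invmx], which is
    given by Cramer's formula only on invertible matrices. *)
Lemma near_eq_is_diff (V W : normedModType R) (f g df : V -> W) (x : V) :
  {near x, f =1 g} -> is_diff x f df -> is_diff x g df.
Proof.
move=> fg [dfx <-]; have fxg : f x = g x by exact: nbhs_singleton fg.
have gE : g \o shift x = cst (g x) + 'd f x +o_ 0 id.
  apply/eqaddoP => e e0.
  have /eqaddoP/(_ e e0) := diff_locally dfx.
  have : \forall h \near 0, f (h + x) = g (h + x).
    have : \forall y \near x, f y = g y by exact: fg.
    by rewrite (near_shift 0 x); apply: filterS => h /=; rewrite subr0.
  by apply: filterS2 => h /= fgh; rewrite !fctE/= fgh fxg.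
have dgE := diff_unique (diff_continuous dfx) gE.
apply: DiffDef; last exact: dgE.
by apply/diff_locallyP; rewrite dgE; split; first exact: diff_continuous.
Qed.

Lemma is_diff_linear (V W : normedModType R) (L : V -> W) x :
  linear L -> continuous L -> is_diff x L L.
Proof.
move=> linL Lc; pose LM := GRing.isLinear.Build _ _ _ _ _ linL.
pose l : {linear V -> W} := HB.pack L LM.
apply: DiffDef; first exact: (@linear_differentiable _ _ _ l).
exact: (@diff_lin _ _ _ l).
Qed.

Variable V : normedModType R.

Lemma is_diff_sum (W : normedModType R) n (f df : 'I_n -> V -> W) x :
  (forall i, is_diff x (f i) (df i)) ->
  is_diff x (fun y => \sum_(i < n) f i y) (fun v => \sum_(i < n) df i v).
Proof.
move=> fdf; rewrite -!fct_sumE; elim/big_ind2: _ => // [|? ? ? ? ? ?].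
  exact: is_diff_cst.
exact: is_diffD.
Qed.

Lemma differentiable_prod n (f : 'I_n -> V -> R) x :
  (forall i, differentiable (f i) x) ->
  differentiable (fun y => \prod_(i < n) f i y) x.
Proof.
move=> df; rewrite -fct_prodE.
by elim/big_ind: _ => // ? ? ? ?; exact: differentiableM.
Qed.

Lemma is_diff_mx m n (f df : V -> 'M[R]_(m, n)) x :
  (forall i j, is_diff x (fun y => f y i j : R) (fun v => df v i j)) ->
  is_diff x f df.
Proof.
move=> fdf.
have -> : f = fun y => \sum_(i < m) \sum_(j < n) f y i j *: delta_mx i j.
  by apply/funext => y; rewrite -matrix_sum_delta.
have -> : df = fun y => \sum_(i < m) \sum_(j < n) df y i j *: delta_mx i j.
  by apply/funext => y; rewrite -matrix_sum_delta.
apply: is_diff_sum => i; apply: is_diff_sum => j.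
have [dij dijE] := fdf i j.
by apply: DiffDef; [exact: differentiableZl|rewrite diffZl// dijE].
Qed.

Lemma is_diff_entry m n (f df : V -> 'M[R]_(m, n)) x i j :
  is_diff x f df -> is_diff x (fun y => f y i j : R) (fun v => df v i j).
Proof.
move=> fdf; apply: (@is_diff_comp _ _ _ _ _ _
  (fun X : 'M[R]_(m, n) => X i j : R) (fun X => X i j)).
apply: is_diff_linear; last exact: coord_continuous.
by move=> a X Y; rewrite !mxE.
Qed.

Lemma differentiable_entry m n (f : V -> 'M[R]_(m, n)) x i j :
  differentiable f x -> differentiable (fun y => f y i j : R) x.
Proof. by move=> /differentiableP/(is_diff_entry i j)[]. Qed.

(** Continuity of [L] comes for free in finite dimension: [L] is expanded over the matrix units,
    which leaves a finite sum of scalar entries times fixed vectors. *)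
Lemma is_diff_linear_mx m n (W : normedModType R) (L : 'M[R]_(m, n) -> W)
    (f df : V -> 'M[R]_(m, n)) x : linear L ->
  is_diff x f df -> is_diff x (fun y => L (f y)) (fun v => L (df v)).
Proof.
move=> linL fdf; pose LM := GRing.isLinear.Build _ _ _ _ _ linL.
pose l : {linear 'M[R]_(m, n) -> W} := HB.pack L LM.
have lE g : (fun y : V => L (g y)) = fun y =>
    \sum_(i < m) \sum_(j < n) g y i j *: l (delta_mx i j).
  apply/funext => y; rewrite -[LHS]/(l (g y)) {1}(matrix_sum_delta (g y)).
  rewrite linear_sum; apply: eq_bigr => i _.
  by rewrite linear_sum; apply: eq_bigr => j _; rewrite linearZ.
rewrite !lE; apply: is_diff_sum => i; apply: is_diff_sum => j.
have [dij dijE] := is_diff_entry i j fdf.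
by apply: DiffDef; [exact: differentiableZl|rewrite diffZl// dijE].
Qed.

Lemma is_diff_mulmx m n p (f df : V -> 'M[R]_(m, n)) (g dg : V -> 'M[R]_(n, p))
    x : is_diff x f df -> is_diff x g dg ->
  is_diff x (fun y => f y *m g y) (fun v => df v *m g x + f x *m dg v).
Proof.
move=> fdf gdg; apply: is_diff_mx => i j.
rewrite [X in is_diff _ X _](_ : _ = fun y => \sum_(k < n) f y i k * g y k j).
rewrite [X in is_diff _ _ X](_ : _ = fun v =>
    \sum_(k < n) (df v i k * g x k j + f x i k * dg v k j)).
- apply: is_diff_sum => k.
  have := is_diffM (is_diff_entry i k fdf) (is_diff_entry k j gdg).
  move=> /is_diff_eq; apply; apply/funext => v.
  by rewrite !fctE /GRing.scale/= addrC mulrC.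
- by apply/funext => v; rewrite !mxE big_split.
- by apply/funext => y; rewrite mxE.
Qed.

Lemma is_diff_col_mx m1 m2 n (f df : V -> 'M[R]_(m1, n))
    (g dg : V -> 'M[R]_(m2, n)) x : is_diff x f df -> is_diff x g dg ->
  is_diff x (fun y => col_mx (f y) (g y)) (fun v => col_mx (df v) (dg v)).
Proof.
move=> fdf gdg; apply: is_diff_mx => i j; case: (splitP i) => k ik.
- have -> : i = lshift m2 k by exact: val_inj.
  under [X in is_diff _ X _]eq_fun do rewrite col_mxEu.
  under [X in is_diff _ _ X]eq_fun do rewrite col_mxEu.
  exact: is_diff_entry.
- have -> : i = rshift m1 k by exact: val_inj.
  under [X in is_diff _ X _]eq_fun do rewrite col_mxEd.
  under [X in is_diff _ _ X]eq_fun do rewrite col_mxEd.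
  exact: is_diff_entry.
Qed.

Lemma differentiable_det n (f : V -> 'M[R]_n) x :
  differentiable f x -> differentiable (fun y => \det (f y)) x.
Proof.
move=> dfx; rewrite /determinant -fct_sumE.
elim/big_ind: _ => [|? ? ? ?|s _]; first exact: differentiable_cst.
- exact: differentiableD.
- apply: differentiableZ; apply: differentiable_prod => i.
  exact: differentiable_entry.
Qed.

Lemma differentiable_mx m n (f : V -> 'M[R]_(m, n)) x :
  (forall i j, differentiable (fun y => f y i j : R) x) -> differentiable f x.
Proof.
move=> df.
suff [] : is_diff x f (fun v => \matrix_(i, j) 'd (fun y => f y i j : R) x v).
  by [].
apply: is_diff_mx => i j; apply: DiffDef => //.
by apply/funext => v; rewrite mxE.
Qed.

Lemma differentiable_adj n (f : V -> 'M[R]_n) x :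
  differentiable f x -> differentiable (fun y => \adj (f y)) x.
Proof.
move=> /differentiableP dfx; apply: differentiable_mx => i j.
rewrite [X in differentiable X _](_ : _ =
    (-1) ^+ (j + i) *: fun y => \det (row' j (col' i (f y)))); last first.
  by apply/funext => y; rewrite mxE.
apply: differentiableZ; apply: differentiable_det.
have linL : linear (fun X : 'M[R]_n => row' j (col' i X)).
  by move=> a X Y; apply/matrixP => k l; rewrite !mxE.
by case: (is_diff_linear_mx linL dfx).
Qed.

Lemma near_unitmx n (f : V -> 'M[R]_n) x : f x \in unitmx ->
  differentiable f x -> \forall y \near x, f y \in unitmx.
Proof.
rewrite unitmxE unitfE => fx0 /differentiable_det/differentiable_continuous.
move=> /(_ [set r | r != 0]) /=.
have : nbhs (\det (f x)) [set r : R | r != 0].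
  by apply: open_nbhs_nbhs; split=> //; exact: open_neq.
move=> nfx /(_ nfx); rewrite /nbhs/=; apply: filterS => y /= fy0.
by rewrite unitmxE unitfE.
Qed.

(** Differentiability comes from Cramer's formula, valid near [x] because the determinant stays
    nonzero there. The value then follows by differentiating [f *m invmx f], which is constant near
    [x], and solving for the unknown term. *)
Lemma is_diff_invmx n (f df : V -> 'M[R]_n) x : f x \in unitmx ->
  is_diff x f df -> is_diff x (fun y => invmx (f y))
    (fun v => - (invmx (f x) *m df v *m invmx (f x))).
Proof.
move=> fxu fdf; have [dfx _] := fdf.
have fu := near_unitmx fxu dfx.
have dinv : differentiable (fun y => invmx (f y)) x.
  pose g y := (\det (f y))^-1 *: \adj (f y).
  have dg : differentiable g x.
    apply: differentiable_mx => i j.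
    rewrite [X in differentiable X _](_ : _ =
        (fun y => (\det (f y))^-1) * (fun y => \adj (f y) i j)); last first.
      by apply/funext => y; rewrite mxE.
    apply: differentiableM.
      apply: differentiableV; first exact: differentiable_det.
      by rewrite -unitfE -unitmxE.
    exact/differentiable_entry/differentiable_adj.
  suff /near_eq_is_diff/(_ (differentiableP dg))[] :
    {near x, g =1 fun y => invmx (f y)} by [].
  by apply: filterS fu => y fyu; rewrite /invmx fyu.
apply: DiffDef => //; apply/funext => v.
have fM := is_diff_mulmx fdf (differentiableP dinv).
have f1 : is_diff x (fun y => f y *m invmx (f y)) (fun=> 0).
  apply: (@near_eq_is_diff _ _ (cst 1%:M)).
  by apply: filterS fu => y fyu; rewrite mulmxV.
have [_ E1] := fM; have [_ E2] := f1.
have /(congr1 (fun h => h v))/= /eqP := etrans (esym E1) E2.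
rewrite addrC addr_eq0 => /eqP dinvE.
by rewrite -[LHS](mulKmx fxu) dinvE mulmxN mulmxA.
Qed.

End matrix_differentials.

(** * From differentials to Jacobian matrices acting on columns *)

Section coljacobian.
Variables (R : realType) (n : nat).
Implicit Types (F : 'cV[R]_n -> 'cV[R]_n) (U v : 'cV[R]_n).

Lemma mulmx_coljacobian F dF U v :
  is_diff U F dF -> coljacobian F U *m v = dF v.
Proof.
move=> FdF.
have linT p q : linear (@trmx R p q) by move=> a X Y; rewrite linearP.
have trd : is_diff (U^T) (fun w : 'rV[R]_n => w^T) (fun w => w^T).
  by apply: is_diff_linear_mx => //; exact: is_diff_id.
have Fd : is_diff (U^T) (fun w : 'rV[R]_n => F w^T) (fun w => dF w^T).
  apply: (@is_diff_comp _ _ _ _ _ _ F dF _ trd).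
  by rewrite trmxK.
have [_ JE] := is_diff_linear_mx (@linT _ _) Fd.
rewrite /coljacobian -[v in LHS]trmxK -trmx_mul /jacobian mul_rV_lin1 JE.
by rewrite !trmxK.
Qed.

Lemma eq_coljacobian F U (M : 'M[R]_n) :
  is_diff U F (mulmx M) -> coljacobian F U = M.
Proof.
move=> FdM; apply/matrixP => i j.
have := mulmx_coljacobian (delta_mx j 0) FdM; rewrite -!colE => /colP/(_ i).
by rewrite !mxE.
Qed.

End coljacobian.

(** * Three-by-three block matrices acting on states *)

Section block_matrices.
Variables (R : realType) (K : nat).
Implicit Types (a b c : 'M[R]_K) (x y z : 'cV[R]_K).

(** The nesting follows [mkstate] and [similmx], so that products are computed blockwise. *)
Definition mx3 a11 a12 a13 a21 a22 a23 a31 a32 a33 : 'M[R]_(K + (K + K)) :=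
  col_mx (row_mx a11 (row_mx a12 a13))
 (col_mx (row_mx a21 (row_mx a22 a23)) (row_mx a31 (row_mx a32 a33))).

Lemma mx3E a11 a12 a13 a21 a22 a23 a31 a32 a33 :
  mx3 a11 a12 a13 a21 a22 a23 a31 a32 a33 =
  block_mx a11 (row_mx a12 a13) (col_mx a21 a31) (block_mx a22 a23 a32 a33).
Proof. by rewrite [RHS]/block_mx -block_mxEh. Qed.

Lemma mx3_1 : mx3 1%:M 0 0 0 1%:M 0 0 0 1%:M = 1%:M.
Proof. by rewrite mx3E row_mx0 col_mx0 -!scalar_mx_block. Qed.

Lemma mulmx3_mkstate a11 a12 a13 a21 a22 a23 a31 a32 a33 x y z :
  mx3 a11 a12 a13 a21 a22 a23 a31 a32 a33 *m mkstate x y z =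
  mkstate (a11 *m x + (a12 *m y + a13 *m z))
          (a21 *m x + (a22 *m y + a23 *m z))
          (a31 *m x + (a32 *m y + a33 *m z)).
Proof. by rewrite /mx3 /mkstate !mul_col_mx !mul_row_col. Qed.

Lemma mulmx3 a11 a12 a13 a21 a22 a23 a31 a32 a33
    b11 b12 b13 b21 b22 b23 b31 b32 b33 :
  mx3 a11 a12 a13 a21 a22 a23 a31 a32 a33 *m
  mx3 b11 b12 b13 b21 b22 b23 b31 b32 b33 =
  mx3 (a11 *m b11 + (a12 *m b21 + a13 *m b31))
      (a11 *m b12 + (a12 *m b22 + a13 *m b32))
      (a11 *m b13 + (a12 *m b23 + a13 *m b33))
      (a21 *m b11 + (a22 *m b21 + a23 *m b31))
      (a21 *m b12 + (a22 *m b22 + a23 *m b32))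
      (a21 *m b13 + (a22 *m b23 + a23 *m b33))
      (a31 *m b11 + (a32 *m b21 + a33 *m b31))
      (a31 *m b12 + (a32 *m b22 + a33 *m b32))
      (a31 *m b13 + (a32 *m b23 + a33 *m b33)).
Proof. by rewrite /mx3 !mul_col_mx !mul_row_col !mul_mx_row !add_row_mx. Qed.

Lemma tr_mx3 a11 a12 a13 a21 a22 a23 a31 a32 a33 :
  (mx3 a11 a12 a13 a21 a22 a23 a31 a32 a33)^T =
  mx3 a11^T a21^T a31^T a12^T a22^T a32^T a13^T a23^T a33^T.
Proof. by rewrite !mx3E !tr_block_mx tr_row_mx tr_col_mx. Qed.

Lemma mkstateK (U : state R K) : mkstate (hpart U) (qxpart U) (qypart U) = U.
Proof. by rewrite /mkstate /hpart /qxpart /qypart !vsubmxK. Qed.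

End block_matrices.

(** * The Galerkin product and the differentials of the fluxes *)

Section fluxes.
Variables (R : realType) (d K : nat).
Variables (rho : Rd R d -> R) (phi : 'I_K -> Rd R d -> R) (g : R).
Implicit Types (z : 'cV[R]_K) (U v : state R K).

Local Notation P := (Pmx rho phi).

Lemma Pmx_linear : linear P.
Proof.
move=> a y z; rewrite /Pmx scaler_sumr -big_split; apply: eq_bigr => k _ /=.
by rewrite !mxE scalerDl scalerA.
Qed.

Lemma PmxE z l m : P z l m =
  \sum_(k < K) z k ord0 * ip rho (phi k) (fun s => phi l s * phi m s).
Proof. by rewrite /Pmx summxE; apply: eq_bigr => k _; rewrite !mxE. Qed.

Lemma Pmx_sym z : (P z)^T = P z.
Proof.
apply/matrixP => l m; rewrite mxE !PmxE; apply: eq_bigr => k _; congr (_ * _).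
by congr (ip _ _ _); apply/funext => s; rewrite mulrC.
Qed.

(** The integral of [phi k * phi l * phi m] is symmetric in its indices, so the Galerkin product is
    commutative. This lets an increment inside [P] be moved to the right, where it is acted on by a
    matrix. *)
Lemma mul_PmxC (y z : 'cV[R]_K) : P y *m z = P z *m y.
Proof.
apply/colP => l; rewrite !mxE.
under eq_bigr do rewrite PmxE mulr_suml.
under [RHS]eq_bigr do rewrite PmxE mulr_suml.
rewrite exchange_big; apply: eq_bigr => k _; apply: eq_bigr => m _ /=.
rewrite mulrAC [RHS]mulrAC; congr (_ * _); first by rewrite mulrC.
congr (Rintegral _ _ _); apply/funext => s; congr (_ * _).
by rewrite mulrCA [RHS]mulrCA (mulrC (phi k s)).
Qed.

Let linh : linear (@hpart R K).
Proof. by move=> a x y; rewrite /hpart linearP. Qed.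
Let linqx : linear (@qxpart R K).
Proof. by move=> a x y; rewrite /qxpart !linearP. Qed.
Let linqy : linear (@qypart R K).
Proof. by move=> a x y; rewrite /qypart !linearP. Qed.

(** Product rule with [H = P(h)] and [d(H^-1) = - H^-1 P(dh) H^-1]. By commutativity of the Galerkin
    product, [P(da) (H^-1 b) = B da] and [P(dh) (H^-1 b) = B dh]. *)
Lemma is_diff_quotient (a b : state R K -> 'cV[R]_K) U :
  linear a -> linear b -> P (hpart U) \in unitmx ->
  let A := P (a U) *m invmx (P (hpart U)) in
  let B := P (invmx (P (hpart U)) *m b U) in
  is_diff U (fun y => P (a y) *m invmx (P (hpart y)) *m b y)
            (fun v => B *m a v - A *m B *m hpart v + A *m b v).
Proof.
move=> lina linb Hu A B.
have idU : is_diff U id id by exact: is_diff_id.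
have dh := is_diff_linear_mx Pmx_linear (is_diff_linear_mx linh idU).
have da := is_diff_linear_mx Pmx_linear (is_diff_linear_mx lina idU).
have db := is_diff_linear_mx linb idU.
have dinv := is_diff_invmx (f := fun y : state R K => P (hpart y)) Hu dh.
have := is_diff_mulmx (is_diff_mulmx da dinv) db.
move=> /is_diff_eq; apply; apply/funext => v /=.
congr (_ + _); rewrite mulmxDl -mulmxA mul_PmxC -/B; congr (_ + _).
rewrite mulmxN mulNmx; congr (- _).
by rewrite !mulmxA -/A -(mulmxA _ _ (b U)) -[LHS]mulmxA mul_PmxC mulmxA.
Qed.

Lemma is_diff_gravity U :
  is_diff U (fun y => (g / 2) *: (P (hpart y) *m hpart y))
            (fun v => (g *: P (hpart U)) *m hpart v).
Proof.
have idU : is_diff U id id by exact: is_diff_id.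
have dh := is_diff_linear_mx linh idU.
have := is_diffZ (g / 2) (is_diff_mulmx (is_diff_linear_mx Pmx_linear dh) dh).
move=> /is_diff_eq; apply; apply/funext => v; rewrite fctE mul_PmxC.
by rewrite -mulr2n -[X in _ *: X]scaler_nat scalerA divfK ?pnatr_eq0// scalemxAl.
Qed.

Section at_state.
Variable U : state R K.
Hypothesis Hu : P (hpart U) \in unitmx.

Let Ax := P (qxpart U) *m invmx (P (hpart U)).
Let Ay := P (qypart U) *m invmx (P (hpart U)).
Let B := P (uhat rho phi U).
Let D := P (vhat rho phi U).
Let gH := g *: P (hpart U).

(** Both [Ax] and [B] stand for the x-velocity of the deterministic Jacobian: [Ax] arises by varying
    the transported momentum, [B] by varying the transporting one. *)
Lemma is_diff_fluxF : is_diff U (fluxF rho phi g)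
  (mulmx (mx3 0 1%:M 0 (gH - Ax *m B) (Ax + B) 0 (- (Ax *m D)) D Ax)).
Proof.
have idU : is_diff U id id by exact: is_diff_id.
have dqx := is_diff_linear_mx linqx idU.
have d1 := is_diff_quotient linqx linqx Hu.
have d2 := is_diff_quotient linqx linqy Hu.
have := is_diff_col_mx dqx
  (is_diff_col_mx (is_diffD d1 (is_diff_gravity U)) d2).
move=> /is_diff_eq; apply; apply/funext => v /=.
rewrite -[in RHS](mkstateK v) mulmx3_mkstate !mul0mx mul1mx add0r !addr0.
rewrite /mkstate fctE -/Ax -/(uhat rho phi U) -/(vhat rho phi U) -/B -/D -/gH.
congr col_mx; congr col_mx.
  rewrite mulmxBl mulmxDl addrC -!addrA; congr (_ + _).
  by rewrite addrCA; congr (_ + _); rewrite addrC.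
by rewrite mulNmx -addrA addrCA.
Qed.

Lemma is_diff_fluxG : is_diff U (fluxG rho phi g)
  (mulmx (mx3 0 0 1%:M (- (Ay *m B)) Ay B (gH - Ay *m D) 0 (Ay + D))).
Proof.
have idU : is_diff U id id by exact: is_diff_id.
have dqy := is_diff_linear_mx linqy idU.
have d1 := is_diff_quotient linqy linqx Hu.
have d2 := is_diff_quotient linqy linqy Hu.
have := is_diff_col_mx dqy
  (is_diff_col_mx d1 (is_diffD d2 (is_diff_gravity U))).
move=> /is_diff_eq; apply; apply/funext => v /=.
rewrite -[in RHS](mkstateK v) mulmx3_mkstate !mul0mx mul1mx !add0r.
rewrite /mkstate fctE -/Ay -/(uhat rho phi U) -/(vhat rho phi U) -/B -/D -/gH.
congr col_mx; congr col_mx.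
  by rewrite mulNmx [RHS]addrA [RHS]addrC addrA.
rewrite mulmxBl mulmxDl addrC -!addrA; congr (_ + _).
by rewrite addrCA; congr (_ + _); rewrite addrC.
Qed.

End at_state.
End fluxes.

(** * Simultaneous symmetrization of the two flux Jacobians *)

Section eigenstructure.
Variables (R : realType) (d K : nat).
Variables (rho : Rd R d -> R) (phi : 'I_K -> Rd R d -> R) (g : R).
Hypothesis g_gt0 : 0 < g.
Variable U : state R K.
Hypothesis posH : posdefmx (Pmx rho phi (hpart U)).

Local Notation P := (Pmx rho phi).
Let Ax := P (qxpart U) *m invmx (P (hpart U)).
Let Ay := P (qypart U) *m invmx (P (hpart U)).
Let B := P (uhat rho phi U).
Let D := P (vhat rho phi U).
Let gH := g *: P (hpart U).
Let E := mxsqrt gH.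
Let E' := invmx E.

Let posgH : posdefmx gH. Proof. exact: posdefmxZ. Qed.
Let Esym : E^T = E. Proof. by have [[]] := mxsqrtP posgH. Qed.
Let EE : E *m E = gH. Proof. by have [] := mxsqrtP posgH. Qed.
Let Eu : E \in unitmx.
Proof. by have [/posdefmx_unit] := mxsqrtP posgH. Qed.

(* [Q] changes the unknowns [(dh, dqx, dqy)] into [dh] and the scaled velocity
   increments [E^-1 (dqx - B dh)], [E^-1 (dqy - D dh)]. *)
Let Q := mx3 1%:M 0 0 (- (E' *m B)) E' 0 (- (E' *m D)) 0 E'.
Let Q' := mx3 1%:M 0 0 B E 0 D 0 E.

Lemma mul_symmetrizer : Q' *m Q = 1%:M.
Proof.
rewrite -mx3_1 mulmx3 !(mul0mx, mulmx0, mul1mx, mulmx1, addr0, add0r) !mulmxN.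
by rewrite !mulKVmx// !subrr mulmxV.
Qed.

Lemma symmetrizer_unit : Q \in unitmx.
Proof. by have [] := mulmx1_unit mul_symmetrizer. Qed.

(* [E^2 = g P(h)] turns [E^-1 P(q) P(h)^-1 E] into [g E^-1 P(q) E^-1]. *)
Lemma conj_sqrt_sym z :
  (E' *m (P z *m invmx (P (hpart U))) *m E)^T =
  E' *m (P z *m invmx (P (hpart U))) *m E.
Proof.
have HE : invmx (P (hpart U)) *m E = g *: E'.
  apply: (mulmx_unitr_inj Eu); rewrite -mulmxA EE /gH -scalemxAr -scalemxAl.
  by rewrite !mulVmx// posdefmx_unit.
rewrite -!mulmxA HE -!scalemxAr mulmxA.
rewrite linearZ/= !trmx_mul trmx_inv Esym Pmx_sym mulmxA.
by [].
Qed.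

Let Sx := E' *m Ax *m E.
Let Sy := E' *m Ay *m E.
Let SF := mx3 B E 0 E Sx 0 0 0 Sx.
Let SG := mx3 D 0 E 0 Sy 0 E 0 Sy.

Let Hu := posdefmx_unit posH.

(** Put [w = E^-1 (dqx - B dh)] and [w' = E^-1 (dqy - D dh)]. The height row gives
    [dqx = B dh + E w]. In the other rows the terms in [B dqx] and [D dqx] cancel, leaving
    [E^-1 (gH dh + Ax E w) = E dh + Sx w] and [E^-1 Ax E w' = Sx w']. *)
Lemma symmetrizer_fluxF :
  Q *m coljacobian (fluxF rho phi g) U = SF *m Q.
Proof.
rewrite (eq_coljacobian (is_diff_fluxF g Hu)) -/gH -/B -/D -/Ax.
rewrite !mulmx3 !(mul0mx, mulmx0, mul1mx, mulmx1, addr0, add0r).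
have SE : Sx *m E' = E' *m Ax by rewrite /Sx mulmxK.
rewrite !mulmxN !(mulmxA Sx) SE mulKVmx// subrr mulmxV//.
rewrite mulmxBr mulmxDr -{1}EE mulKmx// -!mulmxA.
by rewrite addrCA !addNr addr0.
Qed.

Lemma symmetrizer_fluxG :
  Q *m coljacobian (fluxG rho phi g) U = SG *m Q.
Proof.
rewrite (eq_coljacobian (is_diff_fluxG g Hu)) -/gH -/B -/D -/Ay.
rewrite !mulmx3 !(mul0mx, mulmx0, mul1mx, mulmx1, addr0, add0r).
have SE : Sy *m E' = E' *m Ay by rewrite /Sy mulmxK.
rewrite !mulmxN !(mulmxA Sy) SE mulKVmx// subrr mulmxV//.
rewrite mulmxBr mulmxDr -{1}EE mulKmx// -!mulmxA.
by rewrite addrCA !addNr addr0.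
Qed.

Variables nx ny : R.
Hypothesis nxy : nx ^+ 2 + ny ^+ 2 = 1.

Lemma diagonalizable_coljacobian : diagonalizable
  (nx *: coljacobian (fluxF rho phi g) U + ny *: coljacobian (fluxG rho phi g) U).
Proof.
apply: (diagonalizable_similar symmetrizer_unit (B := nx *: SF + ny *: SG)).
  exact: intertwine_lincomb symmetrizer_fluxF symmetrizer_fluxG.
apply: symmetric_diagonalizable; rewrite linearD !linearZ/=.
by rewrite !tr_mx3 !trmx0 /Sx /Sy !conj_sqrt_sym Esym !Pmx_sym.
Qed.

Lemma similmx_unit : similmx rho phi g nx ny U \in unitmx.
Proof.
(* [similmx] is [Q^-1] times a matrix with scalar blocks, which is invertible
   because [(nx, ny)] is a unit vector. *)
pose Rot := mx3 1%:M 0 1%:M nx%:M (- ny)%:M (- nx)%:M ny%:M nx%:M (- ny)%:M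
  : 'M[R]_(K + (K + K)).
pose Rot' := mx3 2^-1%:M (nx / 2)%:M (ny / 2)%:M 0 (- ny)%:M nx%:M
  2^-1%:M (- nx / 2)%:M (- ny / 2)%:M : 'M[R]_(K + (K + K)).
have RotK : Rot *m Rot' = 1%:M.
  have scalarD (a b : R) : a%:M + b%:M = (a + b)%:M :> 'M[R]_K.
    by rewrite raddfD.
  have -> : 1%:M = mx3 1%:M 0%:M 0%:M 0%:M 1%:M 0%:M 0%:M 0%:M 1%:M
    :> 'M[R]_(K + (K + K)) by rewrite raddf0 mx3_1.
  rewrite mulmx3 !(mul0mx, mulmx0, mul1mx, mulmx1, addr0, add0r).
  rewrite -!scalar_mxM !scalarD.
  (* The last two diagonal entries equal [nx ^+ 2 + ny ^+ 2], so there the right-hand side [1] is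
     first replaced by this sum; the other entries are field identities. *)
  by congr (mx3 _%:M _%:M _%:M _%:M _%:M _%:M _%:M _%:M _%:M);
    first [field | rewrite -[RHS]nxy; field].
have -> : similmx rho phi g nx ny U = Q' *m Rot.
  rewrite mulmx3 !(mul0mx, mulmx0, mul1mx, mulmx1, addr0, add0r).
  by rewrite /similmx !mul_mx_scalar !scaleNr.
rewrite unitmx_mul; have [-> _] := mulmx1_unit mul_symmetrizer.
by have [] := mulmx1_unit RotK.
Qed.

(** Conjugation by the invertible [similmx] preserves diagonalizability, and a diagonalization over
    the reals forces the complex spectrum to be real. *)
Lemma flux_jacobian_real_diagonalizable :
  flux_jacobian_defined rho phi g nx ny U /\
  real_diagonalizable (flux_jacobian rho phi g nx ny U).
Proof.
split.
  split=> //; [exact: posdef_sqrt_ex| | |exact: similmx_unit].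
  - by have [] := is_diff_fluxF g Hu.
  - by have [] := is_diff_fluxG g Hu.
apply: diagonalizable_real.
apply: (diagonalizable_similar similmx_unit _ diagonalizable_coljacobian).
by rewrite /flux_jacobian !mulmxA mulmxV ?similmx_unit// mul1mx.
Qed.

End eigenstructure.

(** * Positive definiteness of [Pmx] from positive values at the quadrature nodes *)

Section quadrature.
Variables (R : realType) (d : nat) (rho : Rd R d -> R).
Variables (Lambda : {fset d.-tuple nat}) (K : nat) (phi : 'I_K -> Rd R d -> R).
Hypothesis Lambda0 : [tuple of nseq d 0%N] \in Lambda.
Hypothesis basis_phi : orthonormal_basis rho Lambda phi.

Lemma fspan_sub (S : set (Rd R d -> R)) : S `<=` fspan S.
Proof.
move=> f Sf; exists 1%N, (fun=> 1), (fun=> f); split=> //.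
by apply/funext => s; rewrite big_ord1 mul1r.
Qed.

Lemma polyspace_basis k : polyspace Lambda (phi k).
Proof. by have [_ <-] := basis_phi; apply: fspan_sub; exists k. Qed.

Lemma polyspace1 : polyspace Lambda (fun=> 1 : R).
Proof.
apply: fspan_sub; exists [tuple of nseq d 0%N] => //.
apply/funext => s; rewrite /monomial big1// => i _.
by rewrite (tnth_nth 0%N) nth_nseq if_same expr0.
Qed.

Variables (M : nat) (xi : 'I_M -> Rd R d) (tau : 'I_M -> R).
Hypothesis tau_gt0 : forall m, 0 < tau m.
Hypothesis quad : exact_quadrature rho (polyspace_prod Lambda 3) xi tau.

Lemma quadrature_triple f1 f2 f3 :
  polyspace Lambda f1 -> polyspace Lambda f2 -> polyspace Lambda f3 ->
  ip rho f1 (fun s => f2 s * f3 s) =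
  \sum_(m < M) f1 (xi m) * (f2 (xi m) * f3 (xi m)) * tau m.
Proof.
(* The default [f1] of [nth] is never reached, the index being below 3. *)
move=> V1 V2 V3; pose p (j : 'I_3) := nth f1 [:: f1; f2; f3] j.
have pE : (fun s => f1 s * (f2 s * f3 s)) = fun s => \prod_(j < 3) p j s.
  by apply/funext => s; rewrite !big_ord_recl big_ord0 mulr1.
rewrite /ip quad// pE; apply: fspan_sub; exists p; split=> //.
by case=> [[|[|[]]]].
Qed.

Let Phi : 'M[R]_(K, M) := \matrix_(k, m) phi k (xi m).

Lemma Pmx_quadrature z : Pmx rho phi z =
  Phi *m diag_mx (\row_m (tau m * pce_eval phi z (xi m))) *m Phi^T.
Proof.
apply/matrixP => k l; rewrite PmxE mul_mx_diag mxE.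
under eq_bigr do rewrite (quadrature_triple (polyspace_basis _)
  (polyspace_basis _) (polyspace_basis _)) mulr_sumr.
rewrite exchange_big; apply: eq_bigr => m _; rewrite !mxE /pce_eval.
rewrite mulr_sumr mulr_sumr mulr_suml; apply: eq_bigr => j _ /=.
by ring.
Qed.

(* This is where [0 \in Lambda] enters: it makes [phi_k phi_l = phi_k phi_l 1] a
   product of three elements of [P_Lambda]. *)
Lemma quadrature_orthonormal : Phi *m diag_mx (\row_m tau m) *m Phi^T = 1%:M.
Proof.
apply/matrixP => k l; rewrite mul_mx_diag !mxE.
have [<- _] := basis_phi.
transitivity (ip rho (phi k) (fun s => phi l s * 1)); last first.
  by congr (ip _ _ _); apply/funext => s; rewrite mulr1.
rewrite quadrature_triple//; [|exact: polyspace_basis..|exact: polyspace1].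
by apply: eq_bigr => m _; rewrite !mxE mulr1 mulrAC.
Qed.

(** With [y = Phi^T x], the quadratic form is the sum of [tau_m z(xi_m) y_m^2], and [y] is nonzero
    because [Phi diag(tau)] is a left inverse of [Phi^T]. *)
Lemma Pmx_posdef z :
  (forall m, 0 < pce_eval phi z (xi m)) -> posdefmx (Pmx rho phi z).
Proof.
move=> z_gt0; split=> [|x x0]; first exact: Pmx_sym.
have y0 : Phi^T *m x != 0.
  apply: contraNneq x0 => y0.
  by rewrite -(mul1mx x) -quadrature_orthonormal -mulmxA y0 mulmx0.
rewrite Pmx_quadrature !mulmxA -mulmxA -[x^T *m Phi]trmxK trmx_mul trmxK.
have [_ pos] : posdefmx (diag_mx (\row_m (tau m * pce_eval phi z (xi m)))).
  by apply: posdefmx_diag => m; rewrite mxE mulr_gt0.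
exact: pos.
Qed.

End quadrature.

(** * The time step restriction and positivity at the nodes *)

Section cfl.
Variables (R : realType) (d K M Nx Ny : nat).
Variables (rho : Rd R d -> R) (phi : 'I_K -> Rd R d -> R) (g theta dx dy : R).
Variables (bot botx boty : int -> int -> 'cV[R]_K) (U : int -> int -> state R K).
Variable xi : 'I_M -> Rd R d.

Lemma pce_evalB (a : R) (y z : 'cV[R]_K) s :
  pce_eval phi (y - a *: z) s = pce_eval phi y s - a * pce_eval phi z s.
Proof.
rewrite /pce_eval mulr_sumr -sumrB; apply: eq_bigr => k _.
by rewrite !mxE mulrBl mulrA.
Qed.

Lemma lt_dt_max (dt : R) m i j :
  (dt%:E < dt_max rho phi g theta dx dy bot botx boty U Nx Ny xi)%E ->
  in_grid Nx Ny i j ->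
  (dt%:E < dt_ratio rho phi g theta dx dy bot botx boty U xi m i j)%E.
Proof.
(* Grid cells are numbered from 1, so zero and negative integers are discarded, and cell [i.+1] is
   the term of the minimum with ordinal index [i]. *)
case: i => [[|i]|i]//; case: j => [[|j]|j]//=; last by rewrite /in_grid andbF.
  by rewrite /in_grid andbF.
move=> /bigmin_gtP[_ /(_ m isT)] /bigmin_gtP[_ ltm] /andP[/andP[_ iNx]].
move=> /andP[_ jNy]; have := ltm (Ordinal (iNx : (i < Nx)%N)) isT.
by move=> /bigmin_gtP[_ /(_ (Ordinal (jNy : (j < Ny)%N)) isT)].
Qed.

(** If the flux difference at the node is zero or negative, the update cannot lower the height
    there. If it is positive, the absolute value disappears and the bound says [dt * den < num]. *)
Lemma euler_step_gt0 (dt : R) m i j : 0 < dt ->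
  (dt%:E < dt_ratio rho phi g theta dx dy bot botx boty U xi m i j)%E ->
  0 < pce_eval phi (hpart (U i j)) (xi m) ->
  0 < pce_eval phi (hpart (U i j) -
    dt *: fluxdiff_h rho phi g theta dx dy bot botx boty U i j) (xi m).
Proof.
move=> dt0; rewrite pce_evalB /dt_ratio /=.
set den := pce_eval _ (fluxdiff_h _ _ _ _ _ _ _ _ _ _ _ _) _.
set num := pce_eval _ _ _.
have [->|den0] := eqVneq den 0; first by rewrite mulr0 subr0.
rewrite lte_fin => dtlt num0; rewrite subr_gt0.
have [denle0|den_gt0] := leP den 0.
  by apply: le_lt_trans num0; rewrite mulr_ge0_le0// ltW.
by move: dtlt; rewrite gtr0_norm ?divr_gt0// ltr_pdivlMr.
Qed.

End cfl.

Theorem lemma4p1 (R : realType) (d : nat)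
  (rho : Rd R d -> R) (hrho : density rho) (hmom : finite_moments rho)
  (Lambda : {fset d.-tuple nat}) (hL0 : [tuple of nseq d 0%N] \in Lambda)
  (K : nat) (hK : #|` Lambda| = K)
  (phi : 'I_K -> Rd R d -> R) (hphi : orthonormal_basis rho Lambda phi)
  (hphi1 : forall k : 'I_K, k = 0%N :> nat -> phi k = fun=> 1)
  (g : R) (hg : 0 < g)
  (M : nat) (xi : 'I_M -> Rd R d) (tau : 'I_M -> R)
  (htau : forall m, 0 < tau m)
  (hquad : exact_quadrature rho (polyspace_prod Lambda 3) xi tau)
  (Nx Ny : nat) (dx dy : R) (hdx : 0 < dx) (hdy : 0 < dy)
  (theta : R) (htheta : 1 <= theta <= 2)
  (bot botx boty : int -> int -> 'cV[R]_K)
  (src : nat -> int -> int -> 'cV[R]_(K + K))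
  (t : nat -> R) (U : nat -> int -> int -> state R K) (n : nat)
  (hdt : 0 < t n.+1 - t n)
  (hhyp : hyperbolic_point_values rho phi theta dx dy bot botx boty (U n) Nx Ny)
  (hstep : euler_step rho phi g theta dx dy bot botx boty (U n) Nx Ny
             (t n.+1 - t n) (src n) (U n.+1))
  (hpos : forall (m : 'I_M) (i j : int), in_grid Nx Ny i j ->
            0 < pce_eval phi (hpart (U n i j)) (xi m))
  (hcfl : ((t n.+1 - t n)%:E <
           dt_max rho phi g theta dx dy bot botx boty (U n) Nx Ny xi)%E) :
  forall (i j : int), in_grid Nx Ny i j ->
  forall nx ny : R, nx ^+ 2 + ny ^+ 2 = 1 ->
    flux_jacobian_defined rho phi g nx ny (U n.+1 i j) /\
    real_diagonalizable (flux_jacobian rho phi g nx ny (U n.+1 i j)).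
Proof.
move=> i j ij nx ny nxy; apply: flux_jacobian_real_diagonalizable => //.
(* All that remains is positivity of the updated height at every node, the updated height being
   given by the Euler step. *)
apply: (Pmx_posdef hL0 hphi htau hquad) => m.
have [-> _] := hstep i j ij.
by apply: euler_step_gt0; [|exact: lt_dt_max ij|exact: hpos].
Qed.
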